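(* (a) Every linearly Lindelöf space is weakly linearly Lindelöf; (b) every almost discretely Lindelöf space is weakly linearly Lindelöf; (c) every weakly Lindelöf space is weakly linearly Lindelöf.
   Context: All spaces are topological spaces assumed to be $T_1$. For a space $X$, $\tau^*(X)$ is the family of non-empty open subsets of $X$ and $\tau(x,X)$ is the family of open sets containing $x$. A space is Lindelöf if every open cover has a countable subcover. A space is linearly Lindelöf if every open cover that is linearly ordered by inclusion has a countable subcover. A space $X$ is almost discretely Lindelöf if for any discrete set $D\subset X$ (i.e. $D$ is discrete in its subspace topology) there exists a Lindelöf subspace $L\subset X$ such that $D\subset L$. A space $X$ is weakly Lindelöf if for every open cover $\mathcal{U}$ of $X$ there is a countable $\mathcal{U}'\subset\mathcal{U}$ such that $\bigcup\mathcal{U}'$ is dense in $X$. A space $X$ is weakly linearly Lindelöf if for any family $\mathcal{U}\subset\tau^*(X)$ such that $\kappa=|\mathcal{U}|$ is an uncountable regular cardinal, there is a point $x\in X$ such that every $V\in\tau(x,X)$ intersects $\kappa$-many elements of $\mathcal{U}$. *)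

(* Defs.v *)
From mathcomp Require Import all_boot all_order all_algebra.
From mathcomp Require Import all_classical.
From mathcomp Require Import wochoice topology.

Set Implicit Arguments.
Unset Strict Implicit.
Unset Printing Implicit Defensive.

Local Open Scope classical_set_scope.
Local Open Scope card_scope.

Definition open_cover (X : topologicalType) (U : set (set X)) : Prop :=
  U `<=` open /\ \bigcup_(O in U) O = setT.

Definition lindelof (X : topologicalType) : Prop :=
  forall U : set (set X), open_cover U ->
  exists V : set (set X), [/\ V `<=` U, countable V & open_cover V].

Definition linearly_lindelof (X : topologicalType) : Prop :=
  forall U : set (set X), open_cover U -> total_on U subset ->
  exists V : set (set X), [/\ V `<=` U, countable V & open_cover V].

(* A subset D of X, seen as a type, carries the topology induced by X. *)
Definition discrete_subset (X : topologicalType) (D : set X) : Prop :=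
  forall B : set D, open B.

Definition almost_discretely_lindelof (X : topologicalType) : Prop :=
  forall D : set X, discrete_subset D ->
  exists L : set X, D `<=` L /\ lindelof L.

Definition weakly_lindelof (X : topologicalType) : Prop :=
  forall U : set (set X), open_cover U ->
  exists V : set (set X),
    [/\ V `<=` U, countable V & dense (\bigcup_(O in V) O)].

(* R (read as <=) well-orders T in the order type of the cardinal |T|: every
   initial segment {b | b < a} has cardinality strictly smaller than |T|. *)
Definition initial_well_order (T : Type) (R : rel T) : Prop :=
  well_order R /\ forall a : T, ~ ([set: T] #<= [set b | ~~ R a b]).

Definition cofinal (T : Type) (R : rel T) (C : set T) : Prop :=
  forall a : T, exists2 c, C c & R a c.

(* |A| is a regular cardinal: |A| is infinite and cf(|A|) = |A|, i.e. no
   cofinal subset of the initial ordinal |A| has cardinality less than |A|. *)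
Definition regular_cardinality (T : Type) (A : set T) : Prop :=
  infinite_set A /\
  exists R : rel A, initial_well_order R /\
    forall C : set A, cofinal R C -> C #= A.

Definition weakly_linearly_lindelof (X : topologicalType) : Prop :=
  forall U : set (set X),
  (forall O, U O -> open O /\ O !=set0) ->
  ~ countable U -> regular_cardinality U ->
  exists x : X, forall V : set X, open V -> V x ->
    [set O | U O /\ V `&` O !=set0] #= U.

(* Main.v *)
Require Import Defs.
From mathcomp Require Import all_boot all_order all_algebra.
From mathcomp Require Import all_classical.
From mathcomp Require Import topology.
From mathcomp Require Import wochoice.

(** Suppose that a family [U] of non-empty open sets, of uncountable regular
    cardinality [kappa], violates the conclusion: every point has an open
    neighbourhood meeting fewer than [kappa] members of [U].  Enumerate [U] in
    order type [kappa] as [F i].  By regularity, such a neighbourhood misses a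
    whole tail of the enumeration; call a set with this property vanishing.
    As countable sets of indices are bounded, countable unions of vanishing sets
    are vanishing ([vanishing_bigcup]).  A vanishing set is disjoint from some
    [F i], so it is neither [X] nor dense.

    If [X] is weakly Lindelof, the cover by all vanishing open sets has a
    countable subfamily with dense union, a contradiction.  If [X] is linearly
    Lindelof, the same works with the cover by the largest open sets missing the
    tails from [a] on, which form a chain.  If [X] is almost discretely Lindelof,
    every discrete set lies in a countable union of vanishing open sets, so it is
    enough to find a discrete set that no vanishing set contains
    ([discrete_not_vanishing]).  It is obtained from Zorn's lemma: take points
    [x i] of [F i] with vanishing open neighbourhoods [N i] inside [F i], and a
    maximal set [S] of indices such that, for distinct [i] and [j] in [S], the
    point [x i] is not in [N j].  If a vanishing set contained all [x i] with
    [i] in [S], then [S] would be bounded, hence of size below [kappa]; so some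
    large index [k] would have [F k] disjoint from that set and from all [N i]
    with [i] in [S], and [k] could be added to [S]. *)

Set Implicit Arguments.
Unset Strict Implicit.
Unset Printing Implicit Defensive.

Local Open Scope classical_set_scope.
Local Open Scope card_scope.

(** * Orders of uncountable regular type *)

Lemma well_order_total (T : eqType) (R : rel T) : well_order R -> total R.
Proof.
move=> woR x y; have wo : wo_chain R predT by move=> A _; exact: woR.
by apply: (wo_chainW wo).
Qed.

(** The least of three elements has to be the first one, by antisymmetry. *)
Lemma well_order_transitive (T : eqType) (R : rel T) :
  well_order R -> transitive R.
Proof.
move=> woR y x z Rxy Ryz.
have wo : wo_chain R predT by move=> A _; exact: woR.
have anti u v : R u v -> R v u -> u = v.
  by move=> Ruv Rvu; apply: (wo_chain_antisymmetric wo) => //; rewrite Ruv.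
have [|m [[m_in m_le] _]] := woR (mem [:: x; y; z]).
  by exists x; exact: mem_head.
have [mx my mz] : [/\ R m x, R m y & R m z].
  by split; apply: m_le; rewrite !inE eqxx ?orbT.
move: m_in; rewrite !inE => /or3P[] /eqP mE; subst m => //.
- by rewrite (anti x y).
- by rewrite -(anti y z).
Qed.

Definition bounded_above (T : Type) (R : rel T) (C : set T) : Prop :=
  exists b, forall c, C c -> R c b.

(** These are the only properties of an uncountable regular initial ordinal
    that the topological part of the argument relies on; the last one says that
    a function from a proper initial segment has bounded range. *)
Definition regular_order (T : Type) (R : rel T) : Prop :=
  [/\ total R, transitive R,
      forall C : set T, countable C -> bounded_above R C &
      forall (a : T) (f : T -> T), bounded_above R (f @` [set i | ~~ R a i])].

(** A subset of non-maximal cardinality is not cofinal, hence strictly bounded;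
    countable sets and images of proper initial segments are such subsets. *)
Lemma regular_cardinality_order (T : choiceType) (A : set T) :
  ~ countable A -> regular_cardinality A ->
  exists2 R : rel A, regular_order R &
    forall C : set A, ~ (C #= A) -> exists b, forall c, C c -> ~~ R b c.
Proof.
move=> ncA [_ [R [[woR initR] regR]]].
have totR := well_order_total woR.
have strict (C : set A) : ~ (C #= A) -> exists b, forall c, C c -> ~~ R b c.
  move=> nC; have /existsNP[b nb] : ~ cofinal R C by move=> /regR.
  by exists b => c Cc; apply/negP => Rbc; apply: nb; exists c.
have small (C : set A) : ~ (C #= A) -> bounded_above R C.
  move=> /strict[b bP]; exists b => c /bP.
  by have /orP[|->] := totR c b.
exists R => //; split=> //.
- exact: well_order_transitive.
- move=> C cC; apply: small => CA; apply: ncA.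
  by rewrite -(eq_countable CA).
- move=> a f; apply: small => fA; apply: (initR a).
  apply: (@card_le_trans _ _ _ (f @` [set i | ~~ R a i])).
    by rewrite (card_le_eqr fA) (card_le_eql (card_setT A)).
  exact: card_image_le.
Qed.

(** * Vanishing sets *)

Definition vanishing (I X : Type) (R : rel I) (F : I -> set X) (V : set X) :=
  exists a, forall i, R a i -> V `&` F i = set0.

Definition locally_vanishing (I : Type) (X : topologicalType) (R : rel I)
    (F : I -> set X) : Prop :=
  forall x, exists V, [/\ open V, V x & vanishing R F V].

(** Starting points of the tails missed by the countably many sets have a common
    upper bound, whose tail the union misses. *)
Lemma vanishing_bigcup (I X : Type) (R : rel I) (F : I -> set X)
    (W : set (set X)) :
  regular_order R -> countable W -> W `<=` vanishing R F ->
  vanishing R F (\bigcup_(V in W) V).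
Proof.
move=> [_ trR countR _] cW Wv.
(* The value at sets outside [W] is arbitrary; bounding the empty set provides
   some index. *)
have /choice[a aP] V : exists a, W V -> forall i, R a i -> V `&` F i = set0.
  have [/Wv[a aP]|nW] := pselect (W V); first by exists a.
  by have [b _] := countR set0 (countable0 _); exists b.
have [|b bP] := countR (a @` W); first exact: sub_countable (card_image_le _ _) cW.
exists b => i Rbi; rewrite -subset0 => x [[V WV Vx] Fx].
have <- := aP V WV i (trR _ _ _ (bP _ (imageP a WV)) Rbi).
by split.
Qed.

Lemma vanishing_disjoint (I X : Type) (R : rel I) (F : I -> set X)
    (V : set X) :
  total R -> vanishing R F V -> exists i, V `&` F i = set0.
Proof.
by move=> totR [a aP]; exists a; apply: aP; have := totR a a; rewrite orbb.
Qed.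

(** If no point is as required by weak linear Lindelofness, the enumeration of
    the family by itself is locally vanishing, because fewer than [kappa]
    indices are bounded. *)
Lemma weakly_linearly_lindelof_vanishing (X : topologicalType) :
  (forall (I : Type) (R : rel I) (F : I -> set X), regular_order R ->
    (forall i, open (F i) /\ F i !=set0) -> ~ locally_vanishing R F) ->
  weakly_linearly_lindelof X.
Proof.
move=> noF U Uopen ncU regU.
have [R regR smallR] := regular_cardinality_order ncU regU.
apply: contrapT => nox.
apply: (noF U R (fun i => set_val i) regR) => [i|x].
  exact/Uopen/set_valP.
have [V [oV Vx nV]] : exists V : set X, [/\ open V, V x &
    ~ ([set O | U O /\ V `&` O !=set0] #= U)].
  apply: contrapT => noV; apply: nox; exists x => V oV Vx.
  by apply: contrapT => nV; apply: noV; exists V.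
exists V; split=> //.
pose C : set U := [set i | V `&` set_val i !=set0].
have CE : set_val @` C = [set O | U O /\ V `&` O !=set0].
  apply/seteqP; split=> [_ [i Ci <-]|O [UO VO]].
    by split => //; exact: set_valP.
  by exists (SigSub (mem_set UO)); rewrite /C /= ?set_valE.
have [|b bP] := smallR C.
  move=> CU; apply: nV; rewrite -CE; apply: card_eq_trans CU.
  by apply: inj_card_eq => i j _ _; rewrite set_valE; exact: val_inj.
exists b => i Rbi; apply: contrapT => /eqP/set0P Ci.
by have := bP i Ci; rewrite Rbi.
Qed.

(** * Discrete sets *)

Lemma separated_discrete (X : topologicalType) (D : set X) :
  (forall p, D p ->
    exists G, [/\ open G, G p & forall q, D q -> G q -> q = p]) ->
  discrete_subset D.
Proof.
move=> sepD B.
have /choice[G GP] (p : D) : exists G : set X,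
    [/\ open G, G (set_val p) & forall q, D q -> G q -> q = set_val p].
  exact/sepD/set_valP.
exists (\bigcup_(p in B) G p).
  by apply: bigcup_open => p _; have [] := GP p.
apply/seteqP; split=> [q [p Bp Gq]|q Bq]; last first.
  by exists q => //; have [] := GP q.
have [_ _ /(_ _ (set_valP q) Gq) qp] := GP p.
suff -> : q = p by [].
by move: qp; rewrite set_valE; exact: val_inj.
Qed.

(** Requiring [x i \notin N j] for both orders of each pair, rather than only
    along the enumeration, lets Zorn's lemma replace a transfinite recursion. *)
Lemma exists_maximal_separated (I X : Type) (x : I -> X) (N : I -> set X) :
  exists S : set I,
    (forall i j, S i -> S j -> N j (x i) -> i = j) /\
    (forall k, (forall i, S i -> ~ N i (x k) /\ ~ N k (x i)) -> S k).
Proof.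
pose P (S : set I) := forall i j, S i -> S j -> N j (x i) -> i = j.
have [|S [PS maxS]] := @Zorn_bigcup I P.
  move=> C CP totC i j [A CA Ai] [B CB Bj].
  have [AB|BA] := totC A B CA CB.
    by apply: (CP B CB) => //; exact: AB.
  by apply: (CP A CA) => //; exact: BA.
exists S; split=> // k kP; apply: contrapT => nSk.
apply: (maxS (k |` S)).
  split; first exact: subsetUr.
  by move=> sub; apply: nSk; apply: sub; left.
move=> i j [->|Si] [->|Sj] // Nji.
- by have [] := kP j Sj.
- by have [] := kP i Si.
- exact: PS.
Qed.

(** A vanishing [W] containing the discrete set meets every [F i] with [i] in the
    maximal set [S], which confines [S] to a proper initial segment.  The tails
    missed by the neighbourhoods of the chosen points then start below a common
    bound, and an index [k] beyond that bound and the tail of [W] contradicts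
    maximality. *)
Lemma discrete_not_vanishing (I : Type) (X : topologicalType) (R : rel I)
    (F : I -> set X) :
  regular_order R -> (forall i, open (F i) /\ F i !=set0) ->
  locally_vanishing R F ->
  exists2 D : set X, discrete_subset D &
    forall W, D `<=` W -> ~ vanishing R F W.
Proof.
move=> [totR trR countR segR] oF locF.
have /choice[x xP] i : exists p, F i p by have [_ [p Fp]] := oF i; exists p.
have /choice[V VP] i := locF (x i).
pose N i := V i `&` F i.
have /choice[b bP] i : exists b, forall k, R b k -> V i `&` F k = set0.
  by have [_ _ [b bP]] := VP i; exists b.
have [S [sepS maxS]] := exists_maximal_separated x N.
exists (x @` S).
  apply: separated_discrete => _ [i Si <-]; exists (N i); split.
  - by apply: openI; [have [] := VP i|have [] := oF i].
  - by split=> //; have [] := VP i.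
  - by move=> _ [j Sj <-] Nx; rewrite (sepS _ _ Sj Si Nx).
move=> W SW [a aP].
have Sa i : S i -> ~~ R a i.
  move=> Si; apply/negP => /aP; rewrite -subset0; apply.
  by split; [apply: SW; exists i|exact: xP].
(* Beyond [c], every [F k] is disjoint from all [V i] with [i] in [S]. *)
have [c cP] := segR a b.
have [k kP] := countR [set a; c] (finite_set_countable (finite_set2 a c)).
have [Rak Rck] : R a k /\ R c k by split; apply: kP; [left|right].
suff /Sa : S k by rewrite Rak.
apply: maxS => i Si; split=> -[].
- move=> Vk _; have /bP : R (b i) k.
    by apply: trR Rck; apply: cP; exists i => //; exact: Sa.
  by rewrite -subset0; apply; split; [exact: Vk|exact: xP].
- move=> _ Fk; have := aP k Rak.
  by rewrite -subset0; apply; split; [apply: SW; exists i|exact: Fk].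
Qed.

(** * The three covering properties *)

Lemma linearly_lindelof_not_vanishing (I : Type) (X : topologicalType)
    (R : rel I) (F : I -> set X) :
  linearly_lindelof X -> regular_order R ->
  (forall i, open (F i) /\ F i !=set0) -> ~ locally_vanishing R F.
Proof.
move=> LX regR oF locF; have [totR trR _ _] := regR.
(* Taking, for each tail, the largest open set that misses it turns the
   vanishing open sets into a chain, as linear Lindelofness demands. *)
pose W a := \bigcup_(V in [set V | open V /\
  forall i, R a i -> V `&` F i = set0]) V.
have Wle a c : R a c -> W a `<=` W c.
  move=> Rac p [V [oV aV] Vp]; exists V => //; split=> // i Rci.
  exact: aV (trR _ _ _ Rac Rci).
have Wv a : vanishing R F (W a).
  exists a => i Rai; rewrite -subset0 => p [[V [_ aV] Vp] Fp].
  by rewrite -(aV i Rai); split.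
have [||U [UW cU [_ UT]]] := LX (range W).
- split=> [_ [a _ <-]|]; first by apply: bigcup_open => V [].
  rewrite -subTset => p _; have [V [oV Vp [a aV]]] := locF p.
  by exists (W a); [exists a|exists V].
- move=> _ _ [a _ <-] [c _ <-].
  by have /orP[/Wle|/Wle] := totR a c; [left|right].
have [|i] := vanishing_disjoint totR (vanishing_bigcup (F := F) regR cU _).
  by move=> _ /UW[a _ <-].
by rewrite UT setTI => Fi0; have [_ /set0P/eqP] := oF i.
Qed.

Lemma weakly_lindelof_not_vanishing (I : Type) (X : topologicalType)
    (R : rel I) (F : I -> set X) :
  weakly_lindelof X -> regular_order R ->
  (forall i, open (F i) /\ F i !=set0) -> ~ locally_vanishing R F.
Proof.
move=> LX regR oF locF; have [totR _ _ _] := regR.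
have [|U [UV cU dU]] := LX [set V | open V /\ vanishing R F V].
  split=> [V []//|]; rewrite -subTset => p _.
  by have [V [oV Vp vV]] := locF p; exists V.
have [|i] := vanishing_disjoint totR (vanishing_bigcup (F := F) regR cU _).
  by move=> V /UV[].
have [oFi Fi0] := oF i.
by have [p [Fp Up]] := dU _ Fi0 oFi; rewrite -subset0; apply; split; [exact: Up|].
Qed.

Lemma almost_discretely_lindelof_not_vanishing (I : Type)
    (X : topologicalType) (R : rel I) (F : I -> set X) :
  almost_discretely_lindelof X -> regular_order R ->
  (forall i, open (F i) /\ F i !=set0) -> ~ locally_vanishing R F.
Proof.
move=> LX regR oF locF.
have [D dD Dv] := discrete_not_vanishing regR oF locF.
have [L [DL lL]] := LX D dD.
pose C := [set V : set X | open V /\ vanishing R F V].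
have [|U [UC cU [_ UT]]] := lL [set (set_val : L -> X) @^-1` V | V in C].
  split=> [_ [V [oV _] <-]|]; first by exists V.
  rewrite -subTset => p _; have [V [oV Vp vV]] := locF (set_val p).
  by exists (set_val @^-1` V) => //; exists V.
have /choice[e eP] B : exists V : set X, U B -> C V /\ set_val @^-1` V = B.
  have [/UC[V CV VB]|nUB] := pselect (U B); last by exists set0.
  by exists V.
apply: (Dv (\bigcup_(V in e @` U) V)).
  move=> p Dp; pose q : L := SigSub (mem_set (DL p Dp)).
  have [B UB Bq] : (\bigcup_(B in U) B) q by rewrite UT.
  exists (e B); first by exists B.
  have [_ BE] := eP B UB.
  have : (set_val @^-1` e B) q by rewrite BE.
  by rewrite /= set_valE.
apply: vanishing_bigcup => //; first exact: sub_countable (card_image_le _ _) cU.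
by move=> _ [B UB <-]; have [[]] := eP B UB.
Qed.

Theorem theorem3p14 (X : topologicalType) (X_T1 : accessible_space X) :
  (linearly_lindelof X -> weakly_linearly_lindelof X) /\
  (almost_discretely_lindelof X -> weakly_linearly_lindelof X) /\
  (weakly_lindelof X -> weakly_linearly_lindelof X).
Proof.
split; [|split] => LX; apply: weakly_linearly_lindelof_vanishing => I R F.
- exact: linearly_lindelof_not_vanishing.
- exact: almost_discretely_lindelof_not_vanishing.
- exact: weakly_lindelof_not_vanishing.
Qed.
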